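(* Let $\Lambda$ be a locally-convex, row-finite $k$-graph, $R$ a commutative ring with $1$, and $J\subseteq KP_R(\Lambda)$ a basic graded ideal. Then (i) $J^\perp=I(\Lambda^0\setminus\overline{H}(J))$; (ii) $J^{\perp\perp}=I(\{w\in\Lambda^0: T(w)\subseteq\overline{H}(J)\})$; (iii) $J$ is regular if and only if $H(J)=\{w\in\Lambda^0: T(w)\subseteq\overline{H}(J)\}$.
   Context: A $k$-graph $(\Lambda,d)$ is a countable category with a functor $d:\Lambda\to\mathbb{N}^k$ with unique factorization ($d(\lambda)=m+n$ gives unique $\lambda=\mu\nu$, $d(\mu)=m,d(\nu)=n$); vertices $\Lambda^0$ are degree-$0$ paths, $r,s$ range and source, $e_i$ standard generators. Row-finite: finitely many paths of each degree with each range. $\Lambda^{\le n}=\{\lambda:d(\lambda)\le n,\ d(\lambda)_i<n_i\Rightarrow s(\lambda)\Lambda^{e_i}=\emptyset\}$. Locally-convex: for $i\ne j$, $\lambda\in v\Lambda^{e_i}$, $\mu\in v\Lambda^{e_j}$, $s(\lambda)\Lambda^{e_j}\ne\emptyset\ne s(\mu)\Lambda^{e_i}$. $KP_R(\Lambda)$ is the universal $R$-algebra generated by $p_v$, $s_\lambda,s_{\lambda^*}$ with relations (KP1) $p_v$ mutually orthogonal idempotents; (KP2) $s_\lambda s_\mu=s_{\lambda\mu}$, $s_{\mu^*}s_{\lambda^*}=s_{(\lambda\mu)^*}$, $p_{r(\lambda)}s_\lambda=s_\lambda=s_\lambda p_{s(\lambda)}$, $p_{s(\lambda)}s_{\lambda^*}=s_{\lambda^*}=s_{\lambda^*}p_{r(\lambda)}$;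 (KP3) $s_{\lambda^*}s_\mu=\delta_{\lambda,\mu}p_{s(\lambda)}$ for $\lambda,\mu\in\Lambda^{\le n}$, $n\ne0$; (KP4) $p_v=\sum_{\lambda\in v\Lambda^{\le n}}s_\lambda s_{\lambda^*}$, $n\ne0$. It is $\mathbb{Z}^k$-graded by $KP_R(\Lambda)_n=\mathrm{span}\{s_\alpha s_{\beta^*}:d(\alpha)-d(\beta)=n\}$; an ideal is graded if it contains the homogeneous components of its elements; basic if $rp_v\in I$, $r\ne0$ imply $p_v\in I$. For an ideal $I$: $H(I)=\{v:p_v\in I\}$, $\overline{H}(I)=\{r(\lambda): s(\lambda)\in H(I)\}$, $I^\perp=\{a:ax=xa=0\ \forall x\in I\}$; $I$ is regular if $I^{\perp\perp}=I$. For $H\subseteq\Lambda^0$, $I(H)$ is the ideal generated by $\{p_v:v\in H\}$. For $w\in\Lambda^0$, $T(w)=\{s(\lambda):\lambda\in\Lambda,\ r(\lambda)=w\}$. *)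

(* Defs.v *)
From HB Require Import structures.
From mathcomp Require Import all_boot all_order all_algebra.
Set Implicit Arguments. Unset Strict Implicit. Unset Printing Implicit Defensive.
Import Order.TTheory GRing.Theory Num.Theory.
Local Open Scope ring_scope.

Definition ndeg (k : nat) := {ffun 'I_k -> nat}.
Definition zdeg (k : nat) := {ffun 'I_k -> int}.
Definition dadd k (m n : ndeg k) : ndeg k := [ffun i => (m i + n i)%N].
Definition dzero k : ndeg k := [ffun => 0%N].
Definition dle k (m n : ndeg k) : Prop := forall i, (m i <= n i)%N.
Definition dunit k (i : 'I_k) : ndeg k := [ffun j => nat_of_bool (j == i)].
Definition ddiff k (m n : ndeg k) : zdeg k := [ffun i => (m i)%:Z - (n i)%:Z].

(* k-graphs: a countable category (objects = identity morphisms =     *)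
(* degree-0 paths), with a degree functor to N^k and unique            *)
(* factorisation. kcomp l m is the composite l m (meaningful when      *)
(* ks l = kr m; arbitrary otherwise).                                  *)
Record kgraph (k : nat) := KGraph {
  kpath :> countType;
  kdeg : kpath -> ndeg k;
  kr : kpath -> kpath;
  ks : kpath -> kpath;
  kcomp : kpath -> kpath -> kpath;
  kr_deg : forall l, kdeg (kr l) = dzero k;
  ks_deg : forall l, kdeg (ks l) = dzero k;
  kr_vert : forall v, kdeg v = dzero k -> kr v = v;
  ks_vert : forall v, kdeg v = dzero k -> ks v = v;
  kcomp_r : forall l m, ks l = kr m -> kr (kcomp l m) = kr l;
  kcomp_s : forall l m, ks l = kr m -> ks (kcomp l m) = ks m;
  kcomp_deg : forall l m, ks l = kr m -> kdeg (kcomp l m) = dadd (kdeg l) (kdeg m);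
  kcompA : forall l m n, ks l = kr m -> ks m = kr n ->
     kcomp (kcomp l m) n = kcomp l (kcomp m n);
  kcomp_idl : forall l, kcomp (kr l) l = l;
  kcomp_idr : forall l, kcomp l (ks l) = l;
  kfact : forall l (m n : ndeg k), kdeg l = dadd m n ->
     exists! p : kpath * kpath,
       [/\ ks p.1 = kr p.2, kdeg p.1 = m, kdeg p.2 = n & l = kcomp p.1 p.2]
}.

Section KGraphDefs.
Variables (k : nat) (L : kgraph k).

Definition vertex (v : L) : Prop := kdeg v = dzero k.

Definition row_finite : Prop :=
  forall (v : L) (n : ndeg k), vertex v ->
    exists s : seq L, forall l : L, kr l = v -> kdeg l = n -> l \in s.

Definition no_edge (v : L) (i : 'I_k) : Prop :=
  forall l : L, kr l = v -> kdeg l <> dunit i.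

Definition locally_convex : Prop :=
  forall (i j : 'I_k) (l m : L), i != j -> kr l = kr m ->
    kdeg l = dunit i -> kdeg m = dunit j ->
    ~ no_edge (ks l) j /\ ~ no_edge (ks m) i.

Definition le_path (n : ndeg k) (l : L) : Prop :=
  dle (kdeg l) n /\ (forall i, (kdeg l i < n i)%N -> no_edge (ks l) i).

Definition Tset (w : L) : L -> Prop :=
  fun v => exists l : L, kr l = w /\ ks l = v.

End KGraphDefs.

Record nualg (R : comNzRingType) := NUAlg {
  nua_car :> lmodType R;
  nmul : nua_car -> nua_car -> nua_car;
  nmulA : forall a b c, nmul (nmul a b) c = nmul a (nmul b c);
  nmulDl : forall a b c, nmul (a + b) c = nmul a c + nmul b c;
  nmulDr : forall a b c, nmul a (b + c) = nmul a b + nmul a c;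
  nmulZl : forall (r : R) a b, nmul (r *: a) b = r *: nmul a b;
  nmulZr : forall (r : R) a b, nmul a (r *: b) = r *: nmul a b
}.
Arguments nmul {R} _ _ _.

Definition is_alg_hom (R : comNzRingType) (A B : nualg R) (f : A -> B) : Prop :=
  [/\ forall a b, f (a + b) = f a + f b,
      forall (r : R) a, f (r *: a) = r *: f a
    & forall a b, f (nmul A a b) = nmul B (f a) (f b)].

(* Kumjian-Pask families. s l stands for s_l and ss l for s_{l^*}.     *)
(* Convention: for a vertex v, p_v = s_v = s_{v^*}.                    *)
Section KP.
Variables (k : nat) (L : kgraph k) (R : comNzRingType).

Definition KP_family (B : nualg R) (s ss : L -> B) : Prop :=
  [/\
      forall v : L, vertex v -> ss v = s v,
      forall v w : L, vertex v -> vertex w ->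
        nmul B (s v) (s w) = (if v == w then s v else 0),
      [/\ forall l m : L, ks l = kr m -> nmul B (s l) (s m) = s (kcomp l m),
          forall l m : L, ks l = kr m -> nmul B (ss m) (ss l) = ss (kcomp l m),
          forall l : L, nmul B (s (kr l)) (s l) = s l /\ nmul B (s l) (s (ks l)) = s l
        & forall l : L, nmul B (s (ks l)) (ss l) = ss l /\ nmul B (ss l) (s (kr l)) = ss l],
      forall (n : ndeg k) (l m : L), n != dzero k -> le_path n l -> le_path n m ->
        nmul B (ss l) (s m) = (if l == m then s (ks l) else 0)
    &
      forall (n : ndeg k) (v : L) (e : seq L), vertex v -> n != dzero k -> uniq e ->
        (forall l, l \in e <-> (kr l = v /\ le_path n l)) ->
        s v = \sum_(l <- e) nmul B (s l) (ss l)].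

Definition is_KP_algebra (A : nualg R) (s ss : L -> A) : Prop :=
  KP_family s ss /\
  forall (B : nualg R) (t tt : L -> B), KP_family t tt ->
    (exists f : A -> B, is_alg_hom f /\ forall l, f (s l) = t l /\ f (ss l) = tt l) /\
    (forall f g : A -> B, is_alg_hom f -> is_alg_hom g ->
       (forall l, f (s l) = g (s l) /\ f (ss l) = g (ss l)) -> forall a, f a = g a).

Variables (A : nualg R) (s ss : L -> A).

Definition homog (n : zdeg k) (a : A) : Prop :=
  exists c : seq (R * L * L),
    (forall x, x \in c -> ddiff (kdeg x.1.2) (kdeg x.2) = n) /\
    a = \sum_(x <- c) x.1.1 *: nmul A (s x.1.2) (ss x.2).

Definition is_ideal (I : A -> Prop) : Prop :=
  [/\ I 0, forall a b, I a -> I b -> I (a + b),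
      forall (r : R) a, I a -> I (r *: a),
      forall a x, I a -> I (nmul A x a)
    & forall a x, I a -> I (nmul A a x)].

Definition graded_ideal (I : A -> Prop) : Prop :=
  forall (ns : seq (zdeg k)) (c : zdeg k -> A), uniq ns ->
    (forall n, n \in ns -> homog n (c n)) ->
    I (\sum_(n <- ns) c n) -> forall n, n \in ns -> I (c n).

Definition basic_ideal (I : A -> Prop) : Prop :=
  forall (r : R) (v : L), vertex v -> r != 0 -> I (r *: s v) -> I (s v).

Definition Hset (I : A -> Prop) : L -> Prop := fun v => vertex v /\ I (s v).
Definition Hbar (I : A -> Prop) : L -> Prop :=
  fun v => exists l : L, v = kr l /\ Hset I (ks l).

Definition perp (I : A -> Prop) : A -> Prop :=
  fun a => forall x, I x -> nmul A a x = 0 /\ nmul A x a = 0.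

Definition regular (I : A -> Prop) : Prop := forall a, perp (perp I) a <-> I a.

Definition gen_ideal (H : L -> Prop) : A -> Prop :=
  fun a => forall I, is_ideal I -> (forall v, vertex v -> H v -> I (s v)) -> I a.

End KP.

(* Main.v *)
From HB Require Import structures.
Require Import Defs.
From mathcomp Require Import all_boot all_order all_algebra.
From mathcomp Require Import zify.
From mathcomp Require Import boolp functions.

(** By (KP4) a homogeneous element [x] is a combination of distinct
    [s_a s_{b^*}] with [b] in Lambda^{<= n} for one large [n], and then
    [s_{a^*} x s_b] is the coefficient of [s_a s_{b^*}] times [p_{s(a)}].
    Hence a basic graded ideal [J] is spanned by the [s_a s_{b^*}] with
    [s(a) = s(b)] in [H(J)], and in particular is generated by [H(J)].

    Letting KP(Lambda) act on functions of a boundary path and a degree in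
    Z^k, the second variable recording the grading, one sees that
    [r p_v <> 0] for [r <> 0]; applied to the kernel, the description of
    basic graded ideals shows that the action is faithful and hence that the
    homogeneous components of an element are unique.

    It follows that the annihilator of a basic graded ideal [J] is again
    basic and graded, and that its vertex set is the complement of
    [Hbar(J)].  This is (i); applying (i) to the annihilator of [J] gives
    (ii), and (iii) compares vertex sets. *)

Set Implicit Arguments. Unset Strict Implicit. Unset Printing Implicit Defensive.
Import Order.TTheory GRing.Theory.
Local Open Scope ring_scope.

(** * Paths *)

Section Paths.
Variables (k : nat) (L : kgraph k).
Implicit Types (a b c d l m v w : L) (n : ndeg k) (i j : 'I_k).

Lemma kdeg_compE l m i : ks l = kr m ->
  kdeg (kcomp l m) i = (kdeg l i + kdeg m i)%N.
Proof. by move=> h; rewrite kcomp_deg // ffunE. Qed.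

Lemma vertex_kr l : vertex (kr l).
Proof. exact: kr_deg. Qed.

Lemma vertex_ks l : vertex (ks l).
Proof. exact: ks_deg. Qed.

Lemma ks_kr l : ks (kr l) = kr l.
Proof. exact/ks_vert/kr_deg. Qed.

Lemma kr_ks l : kr (ks l) = ks l.
Proof. exact/kr_vert/ks_deg. Qed.

(** Cancellation gives [b] and [d] the same degree, so both pairs are the unique factorisation of
    one path. *)
Lemma kcomp_inj a b c d : ks a = kr b -> ks c = kr d -> kdeg a = kdeg c ->
  kcomp a b = kcomp c d -> a = c /\ b = d.
Proof.
move=> hab hcd dac e.
have dbd : kdeg b = kdeg d.
  apply/ffunP => i; have := congr1 (fun x => kdeg x i) e.
  by rewrite !kdeg_compE // dac => /addnI.
have [p [_ up]] := kfact (kcomp_deg hab).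
have p1 : p = (a, b) by apply: up.
have p2 : p = (c, d) by apply: up; split.
by move: p1; rewrite p2 => -[-> ->].
Qed.

Lemma kfactor l n : dle n (kdeg l) ->
  exists a b, [/\ ks a = kr b, kdeg a = n & l = kcomp a b].
Proof.
move=> h; have e : kdeg l = dadd n [ffun i => (kdeg l i - n i)%N].
  by apply/ffunP => i; rewrite !ffunE subnKC.
by have [[a b] [[/= h1 h2 _ h3] _]] := kfact e; exists a, b.
Qed.

Lemma has_edgeP v i : ~ no_edge v i -> exists l, kr l = v /\ kdeg l = dunit i.
Proof. by move/existsNP => [l] /not_implyP [h1 /contrapT h2]; exists l. Qed.

Lemma no_edge_deg l i : no_edge (kr l) i -> kdeg l i = 0%N.
Proof.
move=> h; apply/eqP; rewrite -leqn0 leqNgt; apply/negP => lt0.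
have h1 : dle (dunit i) (kdeg l) by move=> j; rewrite ffunE; case: eqP => [->|].
have [a [b [hab da e]]] := kfactor h1.
by apply: (h a) => //; rewrite e kcomp_r.
Qed.

Lemma no_edge_ks l i : no_edge (kr l) i -> no_edge (ks l) i.
Proof.
move=> h a ra da; have := @no_edge_deg (kcomp l a) i.
rewrite kcomp_r // kdeg_compE // da ffunE eqxx => /(_ h); lia.
Qed.

Definition pre a b := exists c, ks a = kr c /\ b = kcomp a c.

Lemma pre_refl a : pre a a.
Proof. by exists (ks a); rewrite kr_ks kcomp_idr. Qed.

Lemma pre_comp a b : ks a = kr b -> pre a (kcomp a b).
Proof. by exists b. Qed.

Lemma pre_trans b a c : pre a b -> pre b c -> pre a c.
Proof.
move=> [x [hx ->]] [y]; rewrite kcomp_s // => -[hy ->].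
by exists (kcomp x y); rewrite kcomp_r // kcompA.
Qed.

Lemma kr_pre a b : pre a b -> kr b = kr a.
Proof. by move=> [x [hx ->]]; rewrite kcomp_r. Qed.

(** What follows [a] in [c] has degree 0 in direction [i], so [a] already carries all the [i]-degree
    of [c]. *)
Lemma kdeg_le_no_edge a b c i : pre a c -> pre b c -> no_edge (ks a) i ->
  (kdeg b i <= kdeg a i)%N.
Proof.
move=> [x [hx ->]] [y [hy e]] h; rewrite hx in h.
have := congr1 (fun z => kdeg z i) e.
rewrite !kdeg_compE // (no_edge_deg h); lia.
Qed.

(** In each direction a path in Lambda^{<= n} has reached [n i] or cannot be continued. Comparison
    inside [c] makes the degrees equal, and unique factorisation applies. *)
Lemma le_path_pre_eq n a b c : pre a c -> pre b c ->
  le_path n a -> le_path n b -> a = b.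
Proof.
move=> pa pb [la ea] [lb eb].
have dab : kdeg a = kdeg b.
  apply/ffunP => i.
  have h1 : (kdeg b i <= kdeg a i)%N.
    have [/ea|] := ltnP (kdeg a i) (n i); first exact: kdeg_le_no_edge pa pb.
    exact/leq_trans/lb.
  have h2 : (kdeg a i <= kdeg b i)%N.
    have [/eb|] := ltnP (kdeg b i) (n i); first exact: kdeg_le_no_edge pb pa.
    exact/leq_trans/la.
  by apply/eqP; rewrite eqn_leq h1 h2.
case: pa pb => [x [hx ->]] [y [hy e]].
by have [] := kcomp_inj hx hy dab e.
Qed.

Lemma le_path_comp n l m : ks l = kr m -> dle (kdeg l) n ->
  le_path [ffun i => (n i - kdeg l i)%N] m -> le_path n (kcomp l m).
Proof.
move=> h hl [hm em]; split=> i.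
  by rewrite kdeg_compE //; have := hm i; have := hl i; rewrite ffunE; lia.
rewrite kdeg_compE // kcomp_s // => lt; apply: em.
by rewrite ffunE; have := hl i; lia.
Qed.

Lemma le_path_refl l : le_path (kdeg l) l.
Proof. by split=> i; rewrite ?leqnn ?ltnn. Qed.

Lemma le_path0 l : le_path (dzero k) l -> vertex l.
Proof.
by move=> [h _]; apply/ffunP => i; have := h i; rewrite ffunE leqn0 => /eqP.
Qed.

(** * Local convexity: moving edges along a path *)

Section LocallyConvex.
Hypothesis lc : locally_convex L.

Lemma kdeg_neq0_edge l i : kdeg l i != 0%N -> exists a b,
  [/\ ks a = kr b, kdeg a = dunit i & l = kcomp a b].
Proof.
move=> h; apply: kfactor => j; rewrite ffunE.
by case: eqP => // ->; rewrite lt0n.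
Qed.

(** Induction on the total degree of [l]: its first edge has a direction [j] other than [i], and
    local convexity carries an [i]-edge from the range of that edge to its source. *)
Lemma edge_transport l i : kdeg l i = 0%N -> ~ no_edge (kr l) i ->
  ~ no_edge (ks l) i.
Proof.
have [N] := ubnP (\sum_j kdeg l j).
elim: N l => // N IH l leN l0 hl.
have [/forallP z|/forallPn /= [j hj]] := boolP [forall j, kdeg l j == 0%N].
  have vl : vertex l by apply/ffunP => j; rewrite ffunE; exact/eqP.
  by rewrite (ks_vert vl) -(kr_vert vl).
have [a [b [hab da e]]] := kdeg_neq0_edge hj; subst l.
have ij : i != j by apply: contraNneq hj => <-; rewrite l0.
rewrite kcomp_s //; rewrite kcomp_r // in hl; rewrite kdeg_compE // in l0.
have hb : ~ no_edge (kr b) i.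
  have [f [hf df]] := has_edgeP hl.
  by have [_] := lc ij hf df da; rewrite hab.
apply: IH hb; last lia.
rewrite -ltnS; apply: leq_trans leN; rewrite ltnS.
have -> : \sum_j kdeg (kcomp a b) j = (\sum_j kdeg a j + \sum_j kdeg b j)%N
  by rewrite -big_split; apply: eq_bigr => ? _; rewrite kdeg_compE.
by rewrite da [X in (X + _)%N](bigD1 j) //= ffunE eqxx; lia.
Qed.

Lemma no_edge_kr l i : kdeg l i = 0%N -> no_edge (ks l) i -> no_edge (kr l) i.
Proof. by move=> l0 h; apply: contrapT => /(edge_transport l0). Qed.

End LocallyConvex.

(** * Row-finiteness: paths of bounded degree *)

Section Finiteness.
Hypothesis rf : row_finite L.

Lemma finite_dle v n : vertex v ->
  exists e : seq L, forall l, kr l = v -> dle (kdeg l) n -> l \in e.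
Proof.
move=> vv; have [e he] := choice (fun n => rf n vv).
(* [N] bounds every coordinate of [n], so the degrees below [n] are among finitely many functions
   into ['I_N.+1]. *)
pose N := \sum_i n i.
pose deg (f : {ffun 'I_k -> 'I_N.+1}) : ndeg k := [ffun i => nat_of_ord (f i)].
exists (flatten [seq e (deg f) | f <- enum {: {ffun 'I_k -> 'I_N.+1}}]) => l rl dl.
apply/flatten_mapP; exists [ffun i => inord (kdeg l i)]; first by rewrite mem_enum.
apply: he => //; apply/ffunP => i; rewrite !ffunE inordK // ltnS.
by apply: leq_trans (dl i) _; rewrite /N (bigD1 i) //= leq_addr.
Qed.

Lemma le_path_enum v n : vertex v ->
  exists2 e : seq L, uniq e & forall l, l \in e <-> kr l = v /\ le_path n l.
Proof.
move=> vv; have [e he] := finite_dle n vv.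
exists (undup [seq l <- e | `[< kr l = v /\ le_path n l >]]); first exact: undup_uniq.
move=> l; rewrite mem_undup mem_filter; split=> [/andP[/asboolP] //|h].
by apply/andP; split; [exact/asboolP | case: h => h1 [h2 _]; exact: he].
Qed.

End Finiteness.

(* A path of maximal length among those of degree at most [n] lies in
   the set of [le_path n]. *)
Lemma le_path_exists v n : vertex v -> exists2 l, kr l = v & le_path n l.
Proof.
move=> vv; pose P N := `[< exists2 l, kr l = v &
  dle (kdeg l) n /\ \sum_i kdeg l i = N >].
have P0 : P 0%N.
  apply/asboolP; exists v; first exact: kr_vert.
  rewrite vv; split=> [i|]; first by rewrite ffunE.
  by rewrite big1 // => i _; rewrite ffunE.
have Pub N : P N -> (N <= \sum_i n i)%N.
  by move=> /asboolP[l _ [dl <-]]; apply: leq_sum.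
have [M /asboolP[l rl [dl Ml]] maxM] := ex_maxnP (ex_intro P _ P0) Pub.
exists l => //; split=> // i lt_i f rf df.
(* An edge [f] in a direction where [l] falls short of [n] would give a longer path still of degree
   at most [n]. *)
have sumE : \sum_j kdeg (kcomp l f) j = M.+1.
  rewrite -Ml (bigD1 i) //= [in RHS](bigD1 i) //= kdeg_compE // df ffunE eqxx.
  rewrite (eq_bigr (kdeg l)) => [|j ji]; first by move: (\sum_(j | _) _)%N => S; lia.
  by rewrite kdeg_compE // df ffunE (negbTE ji) addn0.
suff /maxM : P M.+1 by rewrite ltnn.
apply/asboolP; exists (kcomp l f); first by rewrite kcomp_r.
split=> // j; rewrite kdeg_compE // df ffunE; have := dl j.
by case: eqP => [->|]; lia.
Qed.

End Paths.

(** * Boundary paths *)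

Section BoundaryFilters.
Variables (k : nat) (L : kgraph k).
Implicit Types (a b c d l m v w : L) (n : ndeg k) (i j : 'I_k) (F : L -> Prop).

(* A boundary path, encoded by the set of its initial segments. *)
Definition bfilter F : Prop :=
  [/\ exists a, F a,
      forall a b, pre a b -> F b -> F a,
      forall a b, F a -> F b -> exists c, [/\ F c, pre a c & pre b c]
    & forall i (N : nat), exists2 a, F a & (N <= kdeg a i)%N \/ no_edge (ks a) i].

(** Prepends [l] to a boundary path; closing under [pre] also puts in the initial segments of [l]
    itself. *)
Definition bcat l F : L -> Prop := fun a =>
  exists c, [/\ ks l = kr c, F c & pre a (kcomp l c)].

Definition bcut l F : L -> Prop := fun a => ks l = kr a /\ F (kcomp l a).

Lemma bfilter_pre F a b : bfilter F -> pre a b -> F b -> F a.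
Proof. by case=> _ h _ _; exact: h. Qed.

Lemma bfilter_kr F a : bfilter F -> F a -> F (kr a).
Proof.
move=> bF; apply: bfilter_pre => //.
by exists a; rewrite ks_kr kcomp_idl.
Qed.

Lemma bfilter_vertex F v a : bfilter F -> vertex v -> F v -> F a -> kr a = v.
Proof.
move=> [_ _ dir _] vv Fv Fa; have [c [_ p1 p2]] := dir _ _ Fv Fa.
by rewrite -(kr_pre p2) (kr_pre p1) kr_vert.
Qed.

Lemma pre_kcomp l a b : ks l = kr a -> pre a b -> pre (kcomp l a) (kcomp l b).
Proof.
by move=> la [c [ac ->]]; exists c; rewrite kcomp_s // kcompA.
Qed.

Lemma pre_kcompP l a b : ks l = kr a -> ks l = kr b ->
  pre (kcomp l a) (kcomp l b) -> pre a b.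
Proof.
move=> la lb [c []]; rewrite kcomp_s // => ac; rewrite kcompA // => e.
exists c; split=> //.
by have [] := kcomp_inj lb _ (erefl _) e; rewrite ?kcomp_r.
Qed.

Lemma le_path_bfilter_eq F n a b : bfilter F -> F a -> F b ->
  le_path n a -> le_path n b -> a = b.
Proof.
move=> [_ _ dir _] Fa Fb; have [c [_ pa pb]] := dir _ _ Fa Fb.
exact: le_path_pre_eq pa pb.
Qed.

Lemma bcut_comp l m F : ks l = kr m -> bcut (kcomp l m) F = bcut m (bcut l F).
Proof.
move=> lm; apply/predeqP => a; rewrite /bcut kcomp_s //; split.
  by case=> ma; rewrite kcompA // kcomp_r.
by case=> ma; rewrite kcompA // => -[].
Qed.

Lemma bcut_vertex F v : bfilter F -> vertex v -> F v -> bcut v F = F.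
Proof.
move=> bF vv Fv; apply/predeqP => a; rewrite /bcut (ks_vert vv).
split=> [[-> ]|Fa]; first by rewrite kcomp_idl.
by rewrite -(bfilter_vertex bF vv Fv Fa) kcomp_idl.
Qed.

Lemma bcat_bcut F l : bfilter F -> F l -> bcat l (bcut l F) = F.
Proof.
move=> bF Fl; apply/predeqP => a; split=> [[c [lc [_ Fc] pa]]|Fa].
  exact: bfilter_pre pa Fc.
have [_ _ dir _] := bF; have [c [Fc pac [x [lx e]]]] := dir _ _ Fa Fl.
by exists x; rewrite /bcut -e.
Qed.

Lemma bcut_self F l : bfilter F -> F l -> bcut l F (ks l).
Proof. by move=> bF Fl; rewrite /bcut kr_ks kcomp_idr. Qed.

Lemma bcat_comp_mem F l a : ks l = kr a -> F a -> bcat l F (kcomp l a).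
Proof. by move=> la Fa; exists a; split=> //; exact: pre_refl. Qed.

Lemma bcat_self F l : F (ks l) -> bcat l F l.
Proof. by move=> Fl; have := bcat_comp_mem (esym (kr_ks l)) Fl; rewrite kcomp_idr. Qed.

Lemma bcut_bcat F l : bfilter F -> F (ks l) -> bcut l (bcat l F) = F.
Proof.
move=> bF Fl; apply/predeqP => a; split=> [[la [c [lc Fc pac]]]|Fa].
  exact: bfilter_pre (pre_kcompP la lc pac) Fc.
have la : ks l = kr a by rewrite (bfilter_vertex bF (vertex_ks l) Fl Fa).
by split=> //; exact: bcat_comp_mem.
Qed.

Lemma bfilter_bcat F l : bfilter F -> F (ks l) -> bfilter (bcat l F).
Proof.
move=> bF Fl; have [_ her dir mx] := bF; split.
- by exists l; exact: bcat_self.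
- by move=> a b pab [c [lc Fc pbc]]; exists c; split=> //; exact: pre_trans pab pbc.
- move=> a b [c [lc Fc pac]] [d [ld Fd pbd]].
  have [e [Fe pce pde]] := dir _ _ Fc Fd.
  have le : ks l = kr e by rewrite (kr_pre pce).
  exists (kcomp l e); split; first exact: bcat_comp_mem.
    by apply: pre_trans pac _; exact: pre_kcomp.
  by apply: pre_trans pbd _; exact: pre_kcomp.
move=> i N; have [a Fa ha] := mx i N.
have la : ks l = kr a by rewrite (bfilter_vertex bF (vertex_ks l) Fl Fa).
exists (kcomp l a); first exact: bcat_comp_mem.
rewrite kcomp_s // kdeg_compE //; case: ha; [left; lia | by right].
Qed.

Lemma no_edge_pre a b i : pre a b -> no_edge (ks a) i -> no_edge (ks b) i.
Proof. by move=> [c [ac ->]]; rewrite ac kcomp_s //; exact: no_edge_ks. Qed.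

Lemma kdeg_pre a b i : pre a b -> (kdeg a i <= kdeg b i)%N.
Proof. by move=> [c [ac ->]]; rewrite kdeg_compE // leq_addr. Qed.

Lemma bfilter_bcut F l : bfilter F -> F l -> bfilter (bcut l F).
Proof.
move=> bF Fl; have [_ her dir mx] := bF; split.
- by exists (ks l); exact: bcut_self.
- move=> a b pab [lb Fb]; have la : ks l = kr a by rewrite -(kr_pre pab).
  by split=> //; apply: her Fb; exact: pre_kcomp.
- move=> a b [la Fa] [lb Fb]; have [c [Fc pac pbc]] := dir _ _ Fa Fb.
  have [x [lx e]] := pre_trans (pre_comp la) pac; subst c.
  by exists x; split; [split | exact: pre_kcompP pac | exact: pre_kcompP pbc].
move=> i N; have [a Fa ha] := mx i (kdeg l i + N)%N.
have [c [Fc pac [x [lx e]]]] := dir _ _ Fa Fl; subst c.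
exists x; first by split.
case: ha => [ha|/(no_edge_pre pac)]; last by rewrite kcomp_s //; right.
left; have := kdeg_pre i pac; rewrite kdeg_compE //; lia.
Qed.

(** [F] is a double cut of the right-hand side; [bcut_comp] merges the two cuts and [bcat_bcut]
    undoes the result. *)
Lemma bcat_comp F l m : bfilter F -> ks l = kr m -> F (ks m) ->
  bcat (kcomp l m) F = bcat l (bcat m F).
Proof.
move=> bF lm Fm; have bm := bfilter_bcat bF Fm.
have ml : bcat m F (ks l) by rewrite lm; apply: bfilter_kr bm _; exact: bcat_self.
have bl := bfilter_bcat bm ml.
rewrite -[in LHS](bcut_bcat bF Fm) -[in LHS](bcut_bcat bm ml) -bcut_comp //.
by rewrite bcat_bcut //; apply: bcat_comp_mem => //; exact: bcat_self.
Qed.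

Lemma bcat_vertex F v : bfilter F -> vertex v -> F v -> bcat v F = F.
Proof. by move=> bF vv Fv; rewrite -{1}(bcut_vertex bF vv Fv) bcat_bcut. Qed.

(** By directedness some segment [a] of [F] has, in every direction, reached [n] or come to a stop.
    Its truncation to degree min(n, d(a)) is the required segment. *)
Lemma bfilter_le_path F n : locally_convex L -> bfilter F ->
  exists2 a, F a & le_path n a.
Proof.
move=> lc bF; have [[a0 Fa0] her dir mx] := bF.
have [a Fa ha] : exists2 a, F a & forall i, (n i <= kdeg a i)%N \/ no_edge (ks a) i.
  suff [a Fa ha] : exists2 a, F a &
      forall i, i \in enum 'I_k -> (n i <= kdeg a i)%N \/ no_edge (ks a) i.
    by exists a => // i; apply: ha; rewrite mem_enum.
  elim: (enum 'I_k) => [|i e [a Fa ha]]; first by exists a0.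
  have [b Fb hb] := mx i (n i); have [c [Fc pac pbc]] := dir _ _ Fa Fb.
  exists c => // j; rewrite inE => /predU1P[->|/ha].
    case: hb => h; last by right; apply: no_edge_pre h.
    by left; apply: leq_trans h _; exact: kdeg_pre.
  case=> h; last by right; apply: no_edge_pre h.
  by left; apply: leq_trans h _; exact: kdeg_pre.
have dm : dle [ffun i => minn (n i) (kdeg a i)] (kdeg a).
  by move=> i; rewrite ffunE geq_minr.
have [b [c [bc db e]]] := kfactor dm; subst a.
exists b; first by apply: her Fa; exact: pre_comp.
split=> i; rewrite db ffunE ?geq_minl // => lt_i.
have := congr1 (fun f : ndeg k => f i) db; rewrite ffunE.
have := ha i; rewrite kdeg_compE // kcomp_s // in lt_i *.
(* If [a] stopped before [n i], the removed tail [c] has degree 0 in direction [i], so local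
   convexity moves the absence of [i]-edges back to the end of [b]. *)
case=> [|h]; first lia.
by rewrite bc => ?; apply: (no_edge_kr lc) h; lia.
Qed.

(** Paths from Lambda^{<= (1,...,1)} are appended repeatedly: in each direction every step gains
    degree 1 or reaches a vertex without edges. The initial segments of this sequence form the
    boundary path. *)
Lemma bfilter_exists v : vertex v -> exists2 F, bfilter F & F v.
Proof.
move=> vv; pose one : ndeg k := [ffun => 1%N].
have ext l : exists a, ks l = kr a /\ le_path one a.
  by have [a ra la] := le_path_exists one (vertex_ks l); exists a; rewrite ra.
have [e he] := choice ext.
pose x := fix x t := if t is t'.+1 then kcomp (x t') (e (x t')) else v.
have pre_x t u : (t <= u)%N -> pre (x t) (x u).
  elim: u => [|u IH]; first by rewrite leqn0 => /eqP ->; exact: pre_refl.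
  rewrite leq_eqVlt => /predU1P[->|/IH h]; first exact: pre_refl.
  by apply: pre_trans h _; apply: pre_comp; case: (he (x u)).
exists (fun a => exists t, pre a (x t)); last by exists 0%N; exact: pre_refl.
split.
- by exists v, 0%N; exact: pre_refl.
- by move=> a b pab [t h]; exists t; exact: pre_trans pab h.
- move=> a b [t ha] [u hb]; exists (x (maxn t u)); split.
  + by exists (maxn t u); exact: pre_refl.
  + by apply: pre_trans ha _; apply: pre_x; exact: leq_maxl.
  + by apply: pre_trans hb _; apply: pre_x; exact: leq_maxr.
move=> i N; exists (x N); first by exists N; exact: pre_refl.
elim: N => [|N [IH|IH]]; [by left| |by right; apply: no_edge_pre IH; exact: pre_x].
have [xe [_ le]] := he (x N); rewrite /= kdeg_compE // kcomp_s //.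
have [e0|e0] := posnP (kdeg (e (x N)) i); last by left; lia.
by right; apply: le; rewrite ffunE e0.
Qed.

End BoundaryFilters.

(** * The boundary representation *)

(** The laws are required on [P] only, so this also covers composition of maps, where left
    multiplication is additive only for additive maps. It provides the targets for the universal
    property. *)
Lemma nualg_sub (R : comNzRingType) (V : lmodType R) (mul : V -> V -> V)
    (P : V -> Prop) :
  P 0 -> (forall a b, P a -> P b -> P (a + b)) ->
  (forall (r : R) a, P a -> P (r *: a)) ->
  (forall a b, P a -> P b -> P (mul a b)) ->
  (forall a b c, P a -> P b -> P c -> mul (mul a b) c = mul a (mul b c)) ->
  (forall a b c, P a -> P b -> P c -> mul (a + b) c = mul a c + mul b c) ->
  (forall a b c, P a -> P b -> P c -> mul a (b + c) = mul a b + mul a c) ->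
  (forall (r : R) a b, P a -> P b -> mul (r *: a) b = r *: mul a b) ->
  (forall (r : R) a b, P a -> P b -> mul a (r *: b) = r *: mul a b) ->
  exists (B : nualg R) (i : B -> V),
    [/\ injective i /\ (forall a b, i (nmul B a b) = mul (i a) (i b)),
        forall v, P v -> exists b, i b = v,
        forall b, P (i b),
        forall a b, i (a + b) = i a + i b
      & forall (r : R) a, i (r *: a) = r *: i a].
Proof.
move=> P0 PD PZ PM mA mDl mDr mZl mZr.
pose Q : pred V := fun v => `[< P v >].
have Qc : subsemimod_closed Q.
  split=> [|r u /asboolP h]; last by apply/asboolP; exact: PZ.
  split=> [|u v /asboolP hu /asboolP hv]; first exact/asboolP.
  by apply/asboolP; exact: PD.
pose T := {v : V | Q v}.
pose mixin := GRing.SubChoice_isSubLmodule.Build R V Q T Qc.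
pose W : lmodType R := HB.pack T mixin.
pose i : W -> V := fun w => sval w.
have iP w : P (i w) by apply/asboolP; exact: (svalP w).
have i_inj : injective i by exact: val_inj.
have iD a b : i (a + b) = i a + i b by [].
have iZ (r : R) a : i (r *: a) = r *: i a by [].
pose m (a b : W) : W := exist Q (mul (i a) (i b)) (asboolT (PM _ _ (iP a) (iP b))).
have iM a b : i (m a b) = mul (i a) (i b) by [].
have nA a b c : m (m a b) c = m a (m b c) by apply: i_inj; rewrite !iM mA.
have nDl a b c : m (a + b) c = m a c + m b c.
  by apply: i_inj; rewrite iD !iM iD mDl.
have nDr a b c : m a (b + c) = m a b + m a c.
  by apply: i_inj; rewrite iD !iM iD mDr.
have nZl (r : R) a b : m (r *: a) b = r *: m a b.
  by apply: i_inj; rewrite iZ !iM iZ mZl.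
have nZr (r : R) a b : m a (r *: b) = r *: m a b.
  by apply: i_inj; rewrite iZ !iM iZ mZr.
exists (NUAlg nA nDl nDr nZl nZr), i; split=> // v Pv.
by exists (exist Q v (asboolT Pv)).
Qed.

Section BoundaryRepresentation.
Variables (k : nat) (L : kgraph k) (R : comNzRingType).

(** The first argument ranges over all sets of paths; the operators below return 0 at sets that are
    not boundary paths. *)
Definition bfun := (L -> Prop) -> zdeg k -> R^o.

Definition zd (l : L) : zdeg k := [ffun i => (kdeg l i)%:Z].

(** The action of s_l, supported on the boundary paths that begin with [l]; [ghost_op] is its
    partial inverse. The shift by [zd l] makes degrees visible. *)
Definition path_op (l : L) (f : bfun) : bfun := fun F z =>
  if `[< bfilter F /\ F l >] then f (bcut l F) (z - zd l) else 0.

Definition ghost_op (l : L) (f : bfun) : bfun := fun F z =>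
  if `[< bfilter F /\ F (ks l) >] then f (bcat l F) (z + zd l) else 0.

Definition linear_op (a : bfun -> bfun) : Prop :=
  forall (r : R) f g, a (r *: f + g) = r *: a f + a g.

Lemma linear_op0 a : linear_op a -> a 0 = 0.
Proof.
by move=> la; have := la (-1) 0 0; rewrite scaler0 addr0 scaleN1r addNr => ->.
Qed.

Lemma path_op_linear l : linear_op (path_op l).
Proof.
move=> r f g; apply/funext => F; apply/funext => z.
rewrite !fctE /path_op; case: asboolP => _ //.
by rewrite addr0 /GRing.scale /= mulr0.
Qed.

Lemma ghost_op_linear l : linear_op (ghost_op l).
Proof.
move=> r f g; apply/funext => F; apply/funext => z.
rewrite !fctE /ghost_op; case: asboolP => _ //.
by rewrite addr0 /GRing.scale /= mulr0.
Qed.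

Lemma zd_vertex v : vertex v -> zd v = 0.
Proof. by move=> vv; apply/ffunP => i; rewrite !ffunE vv ffunE. Qed.

Lemma zd_comp l m : ks l = kr m -> zd (kcomp l m) = zd l + zd m.
Proof. by move=> h; apply/ffunP => i; rewrite !ffunE kdeg_compE. Qed.

Lemma path_op_vertex v f F z : vertex v ->
  path_op v f F z = if `[< bfilter F /\ F v >] then f F z else 0.
Proof.
move=> vv; rewrite /path_op; case: asboolP => // -[bF Fv].
by rewrite bcut_vertex // zd_vertex // subr0.
Qed.

Lemma ghost_op_vertex v : vertex v -> ghost_op v = path_op v.
Proof.
move=> vv; apply/funext => f; apply/funext => F; apply/funext => z.
rewrite path_op_vertex // /ghost_op ks_vert //; case: asboolP => // -[bF Fv].
by rewrite bcat_vertex // zd_vertex // addr0.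
Qed.

Lemma path_op_comp l m : ks l = kr m ->
  path_op l \o path_op m = path_op (kcomp l m).
Proof.
move=> lm; apply/funext => f; apply/funext => F; apply/funext => z.
rewrite /path_op /=; case: asboolP => [[bF Fl]|h]; last first.
  case: asboolP => // -[bF Flm]; case: h; split=> //.
  by apply: bfilter_pre Flm => //; exact: pre_comp.
rewrite bcut_comp // zd_comp // opprD addrA.
case: asboolP => [[_ [_ Flm]]|h]; first by rewrite asboolT.
rewrite asboolF // => -[_ Flm]; case: h; split; last by [].
exact: bfilter_bcut.
Qed.

Lemma ghost_op_comp l m : ks l = kr m ->
  ghost_op m \o ghost_op l = ghost_op (kcomp l m).
Proof.
move=> lm; apply/funext => f; apply/funext => F; apply/funext => z.
rewrite /ghost_op /= kcomp_s //; case: asboolP => // -[bF Fm].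
have bm := bfilter_bcat bF Fm.
rewrite asboolT; last first.
  by split=> //; rewrite lm; apply: bfilter_kr => //; exact: bcat_self.
by rewrite bcat_comp // zd_comp // [zd l + _]addrC addrA.
Qed.

(** This is (KP3): two distinct paths in Lambda^{<= n} never begin the same boundary path. *)
Lemma ghost_path_op n l m : le_path n l -> le_path n m ->
  ghost_op l \o path_op m = if l == m then path_op (ks l) else 0.
Proof.
move=> nl nm; apply/funext => f; apply/funext => F; apply/funext => z.
have -> : (if l == m then path_op (ks l) else 0) f F z =
    if (l == m) then path_op (ks l) f F z else 0 by case: eqP.
rewrite path_op_vertex; last exact: vertex_ks.
rewrite /ghost_op /=; case: asboolP => [[bF Fl]|_]; last by case: ifP.
have bl := bfilter_bcat bF Fl; rewrite /path_op.
case: eqP => [<-|ne].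
  by rewrite asboolT ?bcut_bcat ?addrK //; split=> //; exact: bcat_self.
rewrite asboolF // => -[_ Fm]; apply: ne.
exact: le_path_bfilter_eq bl (bcat_self Fl) Fm nl nm.
Qed.

Lemma path_ghost_op l f F z :
  path_op l (ghost_op l f) F z = if `[< bfilter F /\ F l >] then f F z else 0.
Proof.
rewrite /path_op; case: asboolP => // -[bF Fl].
rewrite /ghost_op asboolT; last by split; [exact: bfilter_bcut | exact: bcut_self].
by rewrite bcat_bcut // subrK.
Qed.

(** This is (KP4): a boundary path from [v] has exactly one initial segment in Lambda^{<= n}, so
    exactly one of the projections in the sum fixes it. *)
Lemma sum_path_ghost_op n v (e : seq L) : locally_convex L -> vertex v -> uniq e ->
  (forall l, l \in e <-> kr l = v /\ le_path n l) ->
  path_op v = \sum_(l <- e) (path_op l \o ghost_op l).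
Proof.
move=> lc vv ue he; apply/funext => f; apply/funext => F; apply/funext => z.
have -> : (\sum_(l <- e) (path_op l \o ghost_op l)) f F z =
    \sum_(l <- e) path_op l (ghost_op l f) F z.
  by elim/big_rec2: _ => // l y1 y2 _ <-.
rewrite path_op_vertex //; case: asboolP => [[bF Fv]|h]; last first.
  rewrite big1_seq // => l /andP[_ /he[rl _]]; rewrite path_ghost_op asboolF //.
  by move=> [bF Fl]; apply: h; split=> //; rewrite -rl; exact: bfilter_kr.
have [a Fa na] := bfilter_le_path n lc bF.
have ae : a \in e by apply/he; split=> //; exact: bfilter_vertex Fv Fa.
rewrite (bigD1_seq a) //= path_ghost_op asboolT // big1_seq ?addr0 //.
move=> l /andP[ne /he[_ nl]]; rewrite path_ghost_op asboolF // => -[_ Fl].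
by rewrite (le_path_bfilter_eq bF Fl Fa nl na) eqxx in ne.
Qed.

(** Homogeneity expressed as locality: the value at [z] depends only on the argument at [z - n]. *)
Definition degree_op (n : zdeg k) (a : bfun -> bfun) : Prop :=
  forall f g z F, (forall G, f G (z - n) = g G (z - n)) -> a f F z = a g F z.

Lemma degree_op_path_ghost l m :
  degree_op (ddiff (kdeg l) (kdeg m)) (path_op l \o ghost_op m).
Proof.
move=> f g z F h; rewrite /= /path_op; case: asboolP => // _.
rewrite /ghost_op; case: asboolP => // _.
suff -> : z - zd l + zd m = z - ddiff (kdeg l) (kdeg m) by [].
by apply/ffunP => i; rewrite !ffunE; lia.
Qed.

Lemma degree_opD n a b : degree_op n a -> degree_op n b -> degree_op n (a + b).
Proof. by move=> ha hb f g z F h; rewrite !fctE (ha _ _ _ _ h) (hb _ _ _ _ h). Qed.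

Lemma degree_opZ n (r : R) a : degree_op n a -> degree_op n (r *: a).
Proof. by move=> ha f g z F h; rewrite !fctE (ha _ _ _ _ h). Qed.

Lemma degree_op0 n : degree_op n 0.
Proof. by []. Qed.

(* An operator of degree [n] only sees the values of its argument at
   [z - n], so cutting the argument off there isolates one summand. *)
Lemma degree_op_sum_eq0 (ns : seq (zdeg k)) (c : zdeg k -> bfun -> bfun) : uniq ns ->
  (forall n, n \in ns -> degree_op n (c n) /\ linear_op (c n)) ->
  \sum_(n <- ns) c n = 0 -> forall n, n \in ns -> c n = 0.
Proof.
move=> un hc sum0 n nin; apply/funext => f; apply/funext => F; apply/funext => z.
pose f' : bfun := fun G y => if y == z - n then f G y else 0.
have [dn _] := hc _ nin.
rewrite (dn f f'); last by move=> G; rewrite /f' eqxx.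
have sumE : (\sum_(n <- ns) c n) f' F z = \sum_(n <- ns) c n f' F z.
  by elim/big_rec2: _ => // l y1 y2 _ <-.
have := sumE; rewrite sum0 (bigD1_seq n) //= big1_seq ?addr0 => [<- //|m /andP[mn min]].
have [dm lm] := hc _ min.
rewrite (dm f' 0) => [|G]; first by rewrite (linear_op0 lm).
by rewrite /f' (inj_eq (addrI z)) eqr_opp (negbTE mn).
Qed.

Lemma path_op_vertex_neq0 v (r : R) : vertex v -> r *: path_op v = 0 -> r = 0.
Proof.
move=> vv e; have [F bF Fv] := bfilter_exists vv.
(* The constant function 1, evaluated at a boundary path from [v], returns the scalar [r]. *)
have := congr1 (fun a : bfun -> bfun => a (fun _ _ => 1) F 0) e.
by rewrite !fctE path_op_vertex // asboolT // /GRing.scale /= mulr1.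
Qed.

End BoundaryRepresentation.

(** * Spanning sets of Kumjian-Pask algebras *)

Lemma big_regroup (V : nmodType) (I K : eqType) (key : I -> K)
    (c : seq I) (F : I -> V) :
  \sum_(t <- c) F t =
  \sum_(p <- undup (map key c)) \sum_(t <- c | key t == p) F t.
Proof.
rewrite (exchange_big_dep predT) //= big_seq [RHS]big_seq.
apply: eq_bigr => t tc; rewrite (big_rem (key t)) /=; last first.
  by rewrite mem_undup map_f.
rewrite eqxx big1_seq ?addr0 // => p /andP[/eqP <-].
by rewrite mem_rem_uniqF ?undup_uniq.
Qed.

Section NonUnital.
Variables (R : comNzRingType) (A : nualg R).
Implicit Types a b : A.

Lemma nmul0l b : nmul A 0 b = 0.
Proof. by have := nmulZl 0 (0 : A) b; rewrite !scale0r. Qed.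

Lemma nmul0r b : nmul A b 0 = 0.
Proof. by have := nmulZr 0 b (0 : A); rewrite !scale0r. Qed.

Lemma nmul_suml (I : Type) (c : seq I) (P : pred I) (F : I -> A) b :
  nmul A (\sum_(t <- c | P t) F t) b = \sum_(t <- c | P t) nmul A (F t) b.
Proof. by elim/big_rec2: _ => [|t x y _ <-]; rewrite ?nmul0l ?nmulDl. Qed.

Lemma nmul_sumr (I : Type) (c : seq I) (P : pred I) (F : I -> A) b :
  nmul A b (\sum_(t <- c | P t) F t) = \sum_(t <- c | P t) nmul A b (F t).
Proof. by elim/big_rec2: _ => [|t x y _ <-]; rewrite ?nmul0r ?nmulDr. Qed.

Lemma ideal_sum (J : A -> Prop) (I : eqType) (c : seq I) (F : I -> A) :
  is_ideal J -> (forall t, t \in c -> J (F t)) -> J (\sum_(t <- c) F t).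
Proof.
move=> [J0 JD _ _ _] h; rewrite big_seq.
by elim/big_rec: _ => // t x /h Jt; exact: JD.
Qed.

End NonUnital.

Section Spans.
Variables (k : nat) (L : kgraph k) (R : comNzRingType) (A : nualg R) (s ss : L -> A).
Implicit Types (P Q T : L -> L -> Prop) (x y : A) (l m : L).

Local Notation "a ** b" := (nmul A a b) (at level 40, left associativity).

(** [P] selects the admissible pairs, so that homogeneous components, normal forms and elements of
    ideals are all spans of this kind. *)
Definition span P x : Prop := exists c : seq (R * L * L),
  (forall t, t \in c -> P t.1.2 t.2) /\
  x = \sum_(t <- c) t.1.1 *: (s t.1.2 ** ss t.2).

Lemma span0 P : span P 0.
Proof. by exists [::]; rewrite big_nil. Qed.

Lemma spanD P x y : span P x -> span P y -> span P (x + y).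
Proof.
move=> [c [hc ->]] [d [hd ->]]; exists (c ++ d); rewrite big_cat; split=> // t.
by rewrite mem_cat => /orP[/hc|/hd].
Qed.

Lemma spanZ P (r : R) x : span P x -> span P (r *: x).
Proof.
move=> [c [hc ->]]; exists [seq (r * t.1.1, t.1.2, t.2) | t <- c]; split.
  by move=> _ /mapP[t /hc ? ->].
by rewrite big_map scaler_sumr; apply: eq_bigr => t _; rewrite scalerA.
Qed.

Lemma span_sum P (I : eqType) (c : seq I) (F : I -> A) :
  (forall t, t \in c -> span P (F t)) -> span P (\sum_(t <- c) F t).
Proof.
move=> h; rewrite big_seq; elim/big_rec: _ => [|t x /h ? ?]; first exact: span0.
exact: spanD.
Qed.

Lemma span_gen P l m : P l m -> span P (s l ** ss m).
Proof.
move=> h; exists [:: (1, l, m)]; rewrite big_seq1 scale1r; split=> // t.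
by rewrite inE => /eqP ->.
Qed.

Lemma span_bind P Q x : (forall l m, P l m -> span Q (s l ** ss m)) ->
  span P x -> span Q x.
Proof.
move=> h [c [hc ->]]; apply: span_sum => t tc; apply: spanZ; apply: h; exact: hc.
Qed.

Lemma span_sub P Q x : (forall l m, P l m -> Q l m) -> span P x -> span Q x.
Proof. by move=> h; apply: span_bind => l m /h; exact: span_gen. Qed.

Lemma span_mul P Q T x y :
  (forall a b c d, P a b -> Q c d -> span T ((s a ** ss b) ** (s c ** ss d))) ->
  span P x -> span Q y -> span T (x ** y).
Proof.
move=> h [c [hc ->]] [d [hd ->]]; rewrite nmul_suml; apply: span_sum => t tc.
rewrite nmul_sumr; apply: span_sum => u ud; rewrite nmulZl nmulZr.
by do 2!apply: spanZ; apply: h; [exact: hc | exact: hd].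
Qed.

Lemma homogE n :
  homog s ss n = span (fun l m => ddiff (kdeg l) (kdeg m) = n).
Proof. by []. Qed.

Lemma span_homog x : span (fun _ _ => True) x ->
  exists (ns : seq (zdeg k)) (c : zdeg k -> A),
    [/\ uniq ns, forall n, homog s ss n (c n) & x = \sum_(n <- ns) c n].
Proof.
move=> [c [_ ->]]; pose deg (t : R * L * L) := ddiff (kdeg t.1.2) (kdeg t.2).
exists (undup (map deg c)),
  (fun n => \sum_(t <- c | deg t == n) t.1.1 *: (s t.1.2 ** ss t.2)).
split; [exact: undup_uniq | | exact: big_regroup].
move=> n; exists [seq t <- c | deg t == n]; rewrite big_filter; split=> // t.
by rewrite mem_filter => /andP[/eqP].
Qed.

(** * Consequences of the Kumjian-Pask relations *)

Section Family.
Hypothesis kp : KP_family s ss.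

Lemma s_mul l m : ks l = kr m -> s l ** s m = s (kcomp l m).
Proof. by case: kp => _ _ [h _ _ _] _ _; exact: h. Qed.

Lemma ss_mul l m : ks l = kr m -> ss m ** ss l = ss (kcomp l m).
Proof. by case: kp => _ _ [_ h _ _] _ _; exact: h. Qed.

Lemma s_kr l : s (kr l) ** s l = s l.
Proof. by rewrite s_mul ?ks_kr // kcomp_idl. Qed.

Lemma s_ks l : s l ** s (ks l) = s l.
Proof. by rewrite s_mul ?kr_ks // kcomp_idr. Qed.

Lemma ks_ss l : s (ks l) ** ss l = ss l.
Proof. by case: kp => _ _ [_ _ _ h] _ _; case: (h l). Qed.

Lemma kr_ss l : ss l ** s (kr l) = ss l.
Proof. by case: kp => _ _ [_ _ _ h] _ _; case: (h l). Qed.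

Lemma s_vertex_mul v w : vertex v -> vertex w ->
  s v ** s w = if v == w then s v else 0.
Proof. by case: kp => _ h _ _ _; exact: h. Qed.

Lemma ss_vertex v : vertex v -> ss v = s v.
Proof. by case: kp => h _ _ _ _; exact: h. Qed.

Lemma s_ss_eq0 l m : ks l <> ks m -> s l ** ss m = 0.
Proof.
move=> ne; rewrite -(ks_ss m) -nmulA -(s_ks l) [s l ** _ ** _]nmulA.
rewrite s_vertex_mul; [|exact: vertex_ks|exact: vertex_ks].
by case: eqP => //; rewrite nmul0r nmul0l.
Qed.

Lemma vertex_s_eq0 v l : vertex v -> v <> kr l -> s v ** s l = 0.
Proof.
move=> vv ne; rewrite -(s_kr l) -nmulA s_vertex_mul //; last exact: vertex_kr.
by case: eqP => //; rewrite nmul0l.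
Qed.

Lemma ss_vertex_eq0 v l : vertex v -> v <> kr l -> ss l ** s v = 0.
Proof.
move=> vv ne; rewrite -(kr_ss l) nmulA s_vertex_mul //; last exact: vertex_kr.
by case: eqP => [/esym|]; rewrite ?nmul0r.
Qed.

(** Extends (KP3) to [n] equal to 0, where the paths are vertices and orthogonality gives the same
    formula. *)
Lemma ss_s n l m : le_path n l -> le_path n m ->
  ss l ** s m = if l == m then s (ks l) else 0.
Proof.
have [->|n0] := eqVneq n (dzero k); last by case: kp => _ _ _ h _; exact: h.
move=> /le_path0 vl /le_path0 vm.
by rewrite ss_vertex // s_vertex_mul // ks_vert.
Qed.

Lemma ss_s_deg l m : kdeg l = kdeg m -> ss l ** s m = if l == m then s (ks l) else 0.
Proof.
by move=> e; apply: (@ss_s (kdeg l)); [|rewrite e]; exact: le_path_refl.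
Qed.

Section Expand.
Hypothesis rf : row_finite L.

Lemma s_expand n v : vertex v -> exists2 e : seq L,
  forall l, l \in e -> kr l = v /\ le_path n l &
  s v = \sum_(l <- e) s l ** ss l.
Proof.
move=> vv; have [->|n0] := eqVneq n (dzero k).
  exists [:: v] => [l|]; last by rewrite big_seq1 ss_vertex // s_vertex_mul // eqxx.
  rewrite inE => /eqP ->; split; first exact: kr_vert.
  by have := le_path_refl v; rewrite {1}vv.
have [e ue he] := le_path_enum rf n vv.
exists e => [l /he //|]; case: kp => _ _ _ _ h; exact: h ue he.
Qed.

(** The idempotent at the common source, expanded by (KP4), is inserted between [s a] and [ss b]. *)
Lemma span_expand n a b : ks a = ks b ->
  span (fun c d => exists l, [/\ ks a = kr l, c = kcomp a l, d = kcomp b l & le_path n l])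
    (s a ** ss b).
Proof.
move=> ab; rewrite -(ks_ss b) -ab; have [e he ->] := s_expand n (vertex_ks a).
rewrite nmul_suml nmul_sumr; apply: span_sum => l /he[rl nl].
rewrite nmulA ss_mul; last by rewrite rl.
rewrite -nmulA s_mul //; apply: span_gen.
by exists l.
Qed.

(** With all ghost paths in one Lambda^{<= n}, (KP3) applies to any two of them. *)
Definition normal_pair (n : ndeg k) (z : zdeg k) (a b : L) : Prop :=
  [/\ ks a = ks b, le_path n b & ddiff (kdeg a) (kdeg b) = z].

Lemma ddiff_comp a b l : ks a = kr l -> ks b = kr l ->
  ddiff (kdeg (kcomp a l)) (kdeg (kcomp b l)) = ddiff (kdeg a) (kdeg b).
Proof. by move=> h1 h2; apply/ffunP => i; rewrite !ffunE !kdeg_compE //; lia. Qed.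

Lemma span_normal n a b : dle (kdeg b) n ->
  span (normal_pair n (ddiff (kdeg a) (kdeg b))) (s a ** ss b).
Proof.
move=> bn; have [ab|/eqP ab] := eqVneq (ks a) (ks b); last first.
  by rewrite s_ss_eq0 //; exact: span0.
apply: span_sub (span_expand [ffun i => (n i - kdeg b i)%N] ab) => c d [l [al -> -> nl]].
have bl : ks b = kr l by rewrite -ab.
by split; [rewrite !kcomp_s | exact: le_path_comp | exact: ddiff_comp].
Qed.

Lemma span_normal_l n a b : dle (kdeg a) n ->
  span (fun c d => normal_pair n (ddiff (kdeg b) (kdeg a)) d c) (s a ** ss b).
Proof.
move=> an; have [ab|/eqP ab] := eqVneq (ks a) (ks b); last first.
  by rewrite s_ss_eq0 //; exact: span0.
apply: span_sub (span_expand [ffun i => (n i - kdeg a i)%N] ab) => c d [l [al -> -> nl]].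
have bl : ks b = kr l by rewrite -ab.
by split; [rewrite !kcomp_s | exact: le_path_comp | exact: ddiff_comp].
Qed.

Lemma homog_normal z x : homog s ss z x -> exists n, span (normal_pair n z) x.
Proof.
(* The sum of the degrees of all ghost paths serves as a common upper bound. *)
move=> [c [hc ->]]; exists [ffun i => \sum_(t <- c) kdeg t.2 i].
apply: span_sum => t tc; rewrite -(hc t tc); apply: spanZ; apply: span_normal => i.
by rewrite ffunE (big_rem t) //= leq_addr.
Qed.

(** Both factors are expanded until the two inner paths lie in one Lambda^{<= n}; (KP3) then makes
    the middle product 0 or a vertex idempotent. *)
Lemma homog_mul_gen a b c d :
  homog s ss (ddiff (kdeg a) (kdeg b) + ddiff (kdeg c) (kdeg d))
    ((s a ** ss b) ** (s c ** ss d)).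
Proof.
pose n := dadd (kdeg b) (kdeg c).
have bn : dle (kdeg b) n by move=> i; rewrite ffunE leq_addr.
have cn : dle (kdeg c) n by move=> i; rewrite ffunE leq_addl.
rewrite homogE; apply: span_mul (span_normal a bn) (span_normal_l d cn).
move=> a' b' c' d' [sab nb eab] [sdc nc edc].
rewrite -nmulA [s a' ** _ ** _]nmulA (ss_s nb nc).
case: eqP => [e|_]; last by rewrite nmul0r nmul0l; exact: span0.
rewrite -sab s_ks; apply: span_gen; subst c'.
apply/ffunP => i; move: (congr1 (fun f : zdeg k => f i) eab).
move: (congr1 (fun f : zdeg k => f i) edc).
by rewrite !ffunE; lia.
Qed.

Lemma homog_mul (m n : zdeg k) x y :
  homog s ss m x -> homog s ss n y -> homog s ss (m + n) (x ** y).
Proof.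
by rewrite !homogE; apply: span_mul => p q u v <- <-; exact: homog_mul_gen.
Qed.

Lemma span_True_mul x y : span (fun _ _ => True) x -> span (fun _ _ => True) y ->
  span (fun _ _ => True) (x ** y).
Proof.
apply: span_mul => p q u v _ _; have := homog_mul_gen p q u v.
by rewrite homogE; apply: span_sub.
Qed.

Lemma span_True_s l : span (fun _ _ => True) (s l).
Proof.
rewrite -(s_ks l) -(ss_vertex (vertex_ks l)).
exact: span_gen.
Qed.

Lemma span_True_ss l : span (fun _ _ => True) (ss l).
Proof. by rewrite -(ks_ss l); exact: span_gen. Qed.

(** * Elements of basic graded ideals *)

Section Ideal.
Variable J : A -> Prop.
Hypotheses (idJ : is_ideal J) (bJ : basic_ideal s J).

Definition Hpair (a b : L) : Prop := ks a = ks b /\ Hset s J (ks a).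

(* Sandwiching [x] between [ss a] and [s b] extracts the coefficient of
   [s a ** ss b], as a multiple of the vertex idempotent at [ks a]. *)
Lemma normal_Hpair n z x : span (normal_pair n z) x -> J x -> span Hpair x.
Proof.
move=> [c [hc ex]] Jx; pose key (t : R * L * L) := (t.1.2, t.2).
(* Repeated pairs are merged: [U] lists distinct pairs and [r p] is the total coefficient of [p]. *)
pose U := undup (map key c); pose r p := \sum_(t <- c | key t == p) t.1.1.
have {}ex : x = \sum_(p <- U) r p *: (s p.1 ** ss p.2).
  rewrite ex (big_regroup key); apply: eq_bigr => p _.
  by rewrite scaler_suml; apply: eq_bigr => t /eqP <-.
have hU p : p \in U -> normal_pair n z p.1 p.2.
  by rewrite mem_undup => /mapP[t /hc ? ->].
have [_ _ _ JMl JMr] := idJ.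
rewrite ex; apply: span_sum => p pU; have [sp np zp] := hU p pU.
suff Jr : J (r p *: s (ks p.1)).
  have [->|r0] := eqVneq (r p) 0; first by rewrite scale0r; exact: span0.
  apply: spanZ; apply: span_gen; split=> //; split; first exact: vertex_ks.
  by apply: bJ r0 Jr; exact: vertex_ks.
suff <- : ss p.1 ** x ** s p.2 = r p *: s (ks p.1) by apply: JMr; exact: JMl.
rewrite ex nmul_sumr nmul_suml (bigD1_seq p) ?undup_uniq //= big1_seq.
  rewrite addr0 nmulZr nmulZl -!nmulA (ss_s_deg (erefl (kdeg p.1))) eqxx.
  by rewrite nmulA (ss_s np np) eqxx -sp s_vertex_mul ?eqxx //; exact: vertex_ks.
move=> q /andP[qp qU]; have [sq nq zq] := hU q qU.
rewrite nmulZr nmulZl -!nmulA nmulA (ss_s nq np).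
case: eqP => [e|_]; last by rewrite nmul0r scaler0.
(* Once the ghost paths agree, the common degree [z] forces [p.1] and [q.1] to have equal degree, so
   a nonzero term would give [p] equal to [q]. *)
have dpq : kdeg p.1 = kdeg q.1.
  apply/ffunP => i; have := congr1 (fun f : zdeg k => f i) (etrans zp (esym zq)).
  by rewrite !ffunE e => /addIr [->].
rewrite (ss_s_deg dpq); case: eqP => [e'|_]; last by rewrite nmul0l scaler0.
by case: p q e e' qp {pU qU sp np zp sq nq zq dpq}
  => [p1 p2] [q1 q2] /= -> ->; rewrite eqxx.
Qed.

Lemma graded_Hpair x : span (fun _ _ => True) x -> graded_ideal s ss J ->
  J x -> span Hpair x.
Proof.
move=> /span_homog[ns [c [un hc ->]]] gJ Jx; apply: span_sum => n nin.
have [m hm] := homog_normal (hc n); apply: normal_Hpair hm _.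
exact: gJ un (fun n _ => hc n) Jx n nin.
Qed.

End Ideal.
End Expand.
End Family.
End Spans.

(** * Annihilators of basic graded ideals *)

Section KumjianPask.
Variables (k : nat) (L : kgraph k) (R : comNzRingType) (A : nualg R) (s ss : L -> A).
Hypotheses (lc : locally_convex L) (rf : row_finite L) (kpa : is_KP_algebra s ss).
Implicit Types (x y : A) (J : A -> Prop) (l m v w : L).

Local Notation "a ** b" := (nmul A a b) (at level 40, left associativity).
Local Notation kp := (proj1 kpa).

(* The span is a subalgebra carrying the generating family, so the
   identity of [A] factors through it by the universal property. *)
Lemma KP_span x : span s ss (fun _ _ => True) x.
Proof.
have [kpf univ] := kpa.
have [||||||||B [i [[ii iM] iS iP iD iZ]]] :=
  @nualg_sub R A (nmul A) (span s ss (fun _ _ => True)) (span0 _ _ _).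
- by move=> a b; exact: spanD.
- by move=> r a; exact: spanZ.
- by move=> a b; exact: span_True_mul kpf rf _ _.
- by move=> *; exact: nmulA.
- by move=> *; exact: nmulDl.
- by move=> *; exact: nmulDr.
- by move=> *; exact: nmulZl.
- by move=> *; exact: nmulZr.
have i0 : i 0 = 0 by rewrite -(scale0r (0 : B)) iZ scale0r.
have [t it] := choice (fun l => iS _ (span_True_s kpf l)).
have [tt itt] := choice (fun l => iS _ (span_True_ss kpf l)).
have kpB : KP_family t tt.
  have [kp1 kp2 [kp3 kp4 kp5 kp6] kp7 kp8] := kpf; split.
  - by move=> v vv; apply: ii; rewrite it itt kp1.
  - by move=> v w vv vw; apply: ii; rewrite iM !it kp2 //; case: eqP; rewrite ?it ?i0.
  - split=> [l m lm|l m lm|l|l].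
    + by apply: ii; rewrite iM !it kp3.
    + by apply: ii; rewrite iM !itt kp4.
    + by split; apply: ii; rewrite iM !it; case: (kp5 l).
    by split; apply: ii; rewrite iM it itt; case: (kp6 l).
  - move=> n l m n0 nl nm; apply: ii; rewrite iM it itt (kp7 n) //.
    by case: eqP; rewrite ?it ?i0.
  - move=> n v e vv n0 ue he; apply: ii; rewrite it (kp8 n v e) //.
    by elim/big_rec2: _ => [|l y1 y2 _ ->]; rewrite ?i0 // iD iM it itt.
have [[f [[fD fZ fM] fs]] _] := univ B t tt kpB.
have [_ uniq_hom] := univ A s ss kpf.
have <- : i (f x) = x; last exact: iP.
apply: (uniq_hom (i \o f) id) => //.
  by split=> [a b|r a|a b] /=; rewrite ?fD ?iD ?fZ ?iZ ?fM ?iM.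
by move=> l /=; have [-> ->] := fs l; rewrite it itt.
Qed.

(** The path and ghost operators form a Kumjian-Pask family in the algebra of linear operators, so
    the universal property supplies the map. *)
Lemma boundary_representation : exists phi : A -> bfun L R -> bfun L R,
  [/\ (forall a b, phi (a + b) = phi a + phi b) /\
        (forall (r : R) a, phi (r *: a) = r *: phi a),
      forall a b, phi (a ** b) = phi a \o phi b,
      forall a, linear_op (phi a),
      forall l, phi (s l) = @path_op k L R l
    & forall l, phi (ss l) = @ghost_op k L R l].
Proof.
have [_ univ] := kpa.
pose E : lmodType R := bfun L R -> bfun L R.
have [|||||||||B [i [[ii iM] iS iP iD iZ]]] :=
  @nualg_sub R E (fun a b => a \o b) (@linear_op k L R).
- by move=> r f g; change (0 = r *: (0 : bfun L R) + 0); rewrite scaler0 addr0.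
- move=> a b ha hb r f g.
  change (a (r *: f + g) + b (r *: f + g) = r *: (a f + b f) + (a g + b g)).
  by rewrite ha hb scalerDr addrACA.
- move=> q a ha r f g.
  change (q *: a (r *: f + g) = r *: (q *: a f) + q *: a g).
  by rewrite ha scalerDr !scalerA [q * r]mulrC.
- by move=> a b ha hb r f g /=; rewrite hb ha.
- by [].
- by [].
- move=> a b c ha _ _; apply/funext => f; change (a (b f + c f) = a (b f) + a (c f)).
  by have := ha 1 (b f) (c f); rewrite !scale1r.
- by [].
- move=> r a b ha _; apply/funext => f; change (a (r *: b f) = r *: a (b f)).
  by have := ha r (b f) 0; rewrite (linear_op0 ha) !addr0.
have i0 : i 0 = 0 by rewrite -(scale0r (0 : B)) iZ scale0r.
have [t it] := choice (fun l => iS _ (@path_op_linear k L R l)).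
have [tt itt] := choice (fun l => iS _ (@ghost_op_linear k L R l)).
have kpB : KP_family t tt.
  split.
  - by move=> v vv; apply: ii; rewrite it itt ghost_op_vertex.
  - move=> v w vv vw; apply: ii; rewrite iM !it.
    (* Orthogonality of vertices is the degree 0 case of [ghost_path_op]. *)
    have := @ghost_path_op k L R (dzero k) v w.
    rewrite ghost_op_vertex // ks_vert // => ->; first by case: eqP; rewrite ?it ?i0.
      by rewrite -vv; exact: le_path_refl.
    by rewrite -vw; exact: le_path_refl.
  - split=> [l m lm|l m lm|l|l].
    + by apply: ii; rewrite iM !it path_op_comp.
    + by apply: ii; rewrite iM !itt ghost_op_comp.
    + by split; apply: ii;
        rewrite iM !it path_op_comp ?ks_kr ?kr_ks ?kcomp_idl ?kcomp_idr.
    split; apply: ii; rewrite iM it itt -ghost_op_vertex;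
      try exact: kr_deg; try exact: ks_deg.
      by rewrite ghost_op_comp ?kr_ks // kcomp_idr.
    by rewrite ghost_op_comp ?ks_kr // kcomp_idl.
  - move=> n l m n0 nl nm; apply: ii; rewrite iM it itt (ghost_path_op _ nl nm).
    by case: eqP; rewrite ?it ?i0.
  - move=> n v e vv n0 ue he; apply: ii; rewrite it (sum_path_ghost_op R lc vv ue he).
    by elim/big_rec2: _ => [|l y1 y2 _ ->]; rewrite ?i0 // iD iM it itt.
have [[f [[fD fZ fM] fs]] _] := univ B t tt kpB.
exists (i \o f); split=> [|a b|a|l|l] /=.
- by split=> [a b|r a]; rewrite ?fD ?fZ ?iD ?iZ.
- by rewrite fM iM.
- exact: iP.
- by have [-> _] := fs l.
- by have [_ ->] := fs l.
Qed.

(* The kernel of the boundary representation is a basic graded ideal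
   containing no vertex idempotent. *)
Lemma KP_faithful : exists2 phi : A -> bfun L R -> bfun L R,
  (forall a, phi a = 0 -> a = 0) &
  [/\ (forall a b, phi (a + b) = phi a + phi b) /\
        (forall (r : R) a, phi (r *: a) = r *: phi a),
      forall n a, homog s ss n a -> degree_op n (phi a),
      forall a, linear_op (phi a)
    & forall l, phi (s l) = @path_op k L R l].
Proof.
have [phi [[pD pZ] pM pl ps pss]] := boundary_representation.
have p0 : phi 0 = 0 by rewrite -(scale0r (0 : A)) pZ scale0r.
have pdeg n a : homog s ss n a -> degree_op n (phi a).
  move=> [c [hc ->]]; rewrite big_seq.
  elim/big_rec: _ => [|t x /hc <- hx]; first by rewrite p0; exact: degree_op0.
  rewrite pD pZ pM ps pss; apply: degree_opD hx; apply: degree_opZ.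
  exact: degree_op_path_ghost.
exists phi => //; pose K a := phi a = 0.
have idK : is_ideal K.
  split=> [|a b|r a|a y|a y]; rewrite /K.
  - exact: p0.
  - by rewrite pD => -> ->; rewrite addr0.
  - by rewrite pZ => ->; rewrite scaler0.
  - move=> a0; rewrite pM a0; apply/funext => f /=.
    exact: linear_op0.
  - by move=> a0; rewrite pM a0.
(* No nonzero multiple of a vertex idempotent lies in the kernel, so the kernel is vacuously
   basic. *)
have K_eq0 (r : R) v : vertex v -> K (r *: s v) -> r = 0.
  by move=> vv; rewrite /K pZ ps; exact: path_op_vertex_neq0.
have bK : basic_ideal s K.
  by move=> r v vv r0 /K_eq0 e; rewrite e ?eqxx in r0.
have gK : graded_ideal s ss K.
  move=> ns c un hc Ks n nin.
  apply: (degree_op_sum_eq0 (c := fun n => phi (c n)) un) nin => [m min|].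
    by split=> //; apply: pdeg; exact: hc.
  rewrite -[RHS]Ks; elim/big_rec2: _ => [|m y1 y2 _ ->]; first by rewrite p0.
  by rewrite pD.
move=> a Ka.
have [c [hc ->]] := graded_Hpair kp rf idK bK (KP_span a) gK Ka.
rewrite big1_seq // => t /andP[_ /hc[_ [vt]]].
rewrite -[s _]scale1r => /(K_eq0 _ _ vt)/eqP.
by rewrite oner_eq0.
Qed.

Lemma KP_vertex_neq0 (r : R) v : vertex v -> r *: s v = 0 -> r = 0.
Proof.
move=> vv e; have [phi _ [[_ pZ] _ _ ps]] := KP_faithful.
apply: path_op_vertex_neq0 vv _; rewrite -ps -pZ e.
by rewrite -(scale0r (0 : A)) pZ scale0r.
Qed.

(** Uniqueness of homogeneous components, transported from operators of distinct degrees by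
    faithfulness. *)
Lemma KP_graded0 : graded_ideal s ss (fun x => x = 0).
Proof.
have [phi inj [[pD pZ] pdeg pl _]] := KP_faithful.
have p0 : phi 0 = 0 by rewrite -(scale0r (0 : A)) pZ scale0r.
move=> ns c un hc sum0 n nin; apply: inj.
apply: (degree_op_sum_eq0 (c := fun n => phi (c n)) un) nin => [m min|].
  by split=> //; apply: pdeg; exact: hc.
rewrite -[RHS]p0 -sum0; elim/big_rec2: _ => [|m y1 y2 _ ->]; first by rewrite p0.
by rewrite pD.
Qed.

Lemma perp_ideal J : is_ideal J -> is_ideal (perp J).
Proof.
move=> [_ _ _ JMl JMr]; split=> [|a b ha hb|r a ha|a x ha|a x ha] y Jy.
- by rewrite nmul0l nmul0r.
- rewrite nmulDl nmulDr; have [-> ->] := ha y Jy; have [-> ->] := hb y Jy.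
  by rewrite addr0.
- by rewrite nmulZl nmulZr; have [-> ->] := ha y Jy; rewrite scaler0.
- split; first by rewrite nmulA (ha y Jy).1 nmul0r.
  by rewrite -nmulA (ha _ (JMr _ x Jy)).2.
- split; first by rewrite nmulA (ha _ (JMl _ x Jy)).1.
  by rewrite -nmulA (ha y Jy).2 nmul0l.
Qed.

(** * Vertices and grading of the annihilator *)

Section BasicGraded.
Variable J : A -> Prop.
Hypotheses (idJ : is_ideal J) (bJ : basic_ideal s J) (gJ : graded_ideal s ss J).

Lemma ideal_Hpair x : J x -> span s ss (Hpair s J) x.
Proof. exact: (graded_Hpair kp rf idJ bJ (KP_span x) gJ). Qed.

Lemma basic_graded_generated x : J x <-> gen_ideal s (Hset s J) x.
Proof.
split=> [|h]; last by apply: (h J idJ) => v _ [].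
move=> /ideal_Hpair[c [hc ->]] I idI hI; apply: ideal_sum => // t /hc[tt Ht].
have [_ _ IZ IMl IMr] := idI; apply: IZ; rewrite -(s_ks kp t.1.2).
by apply: IMr; apply: IMl; apply: hI => //; case: Ht.
Qed.

(** [J] is spanned by pairs with source in H(J). Outside [Hbar] no such path has range [v], so every
    product with [s v] vanishes. *)
Lemma perp_vertex v : vertex v -> ~ Hbar s J v -> perp J (s v).
Proof.
move=> vv nv x /ideal_Hpair[c [hc ->]]; rewrite nmul_sumr nmul_suml.
split; rewrite big1_seq // => t /andP[_ /hc[tt Ht]].
  rewrite nmulZr -nmulA (vertex_s_eq0 kp) ?nmul0l ?scaler0 // => e.
  by apply: nv; exists t.1.2.
rewrite nmulZl nmulA (ss_vertex_eq0 kp) ?nmul0r ?scaler0 // => e.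
by apply: nv; exists t.2; rewrite -tt.
Qed.

(** If [l] runs from [v] into H(J), then [s l] is in [J], so [r *: s l] is 0; multiplying by [ss l]
    kills [r] times a vertex idempotent. Keeping [r] general serves basicness too. *)
Lemma perp_vertex_notin (r : R) v : vertex v -> r != 0 -> perp J (r *: s v) ->
  ~ Hbar s J v.
Proof.
move=> vv r0 hp [l [e [vl Jl]]]; subst v; have [_ _ _ JMl _] := idJ.
have Js : J (s l) by rewrite -(s_ks kp l); exact: JMl.
have [+ _] := hp _ Js; rewrite nmulZl (s_kr kp) => rl0.
have : r *: s (ks l) = 0.
  rewrite -[s (ks l)](_ : ss l ** s l = _) -?nmulZr ?rl0 ?nmul0r //.
  by rewrite (ss_s_deg kp) // eqxx.
by move/(KP_vertex_neq0 vl)/eqP; rewrite (negbTE r0).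
Qed.

Lemma Hset_perp v : Hset s (perp J) v <-> vertex v /\ ~ Hbar s J v.
Proof.
split=> -[vv h]; split=> //; last exact: perp_vertex.
by apply: (@perp_vertex_notin 1) => //; rewrite ?oner_eq0 // scale1r.
Qed.

Lemma perp_basic : basic_ideal s (perp J).
Proof.
by move=> r v vv r0 /(perp_vertex_notin vv r0); exact: perp_vertex.
Qed.

(** As [J] is graded, it suffices to test against homogeneous [d j] in [J]. The products with the
    [c i] have distinct degrees and sum to 0, so each vanishes by [KP_graded0]. *)
Lemma perp_graded : graded_ideal s ss (perp J).
Proof.
move=> ns c un hc hs n nin x.
have [ms [d [um hd ->]]] := span_homog (KP_span x) => Jd.
rewrite nmul_sumr nmul_suml.
have {}Jd j : j \in ms -> J (d j) by exact: gJ um (fun i _ => hd i) Jd j.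
split; rewrite big1_seq // => j /andP[_ jms]; have [e1 e2] := hs _ (Jd j jms).
  (* The products are reindexed by their own degree [i + j]. *)
  have h := @KP_graded0 [seq i + j | i <- ns] (fun p => c (p - j) ** d j).
  rewrite -[n](addrK j); apply: h (n + j) _; last by apply/mapP; exists n.
  - by rewrite map_inj_uniq //; exact: addIr.
  - move=> _ /mapP[i iin ->]; rewrite addrK.
    by apply: (homog_mul kp rf) => //; exact: hc.
  rewrite big_map -[RHS]e1 nmul_suml.
  by apply: eq_bigr => i _; rewrite addrK.
have h := @KP_graded0 [seq i + j | i <- ns] (fun p => d j ** c (p - j)).
rewrite -[n](addrK j); apply: h (n + j) _; last by apply/mapP; exists n.
- by rewrite map_inj_uniq //; exact: addIr.
- move=> _ /mapP[i iin ->]; rewrite addrK addrC.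
  by apply: (homog_mul kp rf) => //; exact: hc.
rewrite big_map -[RHS]e2 nmul_sumr.
by apply: eq_bigr => i _; rewrite addrK.
Qed.

End BasicGraded.

Lemma gen_ideal_ext (H K : L -> Prop) : (forall v, H v <-> K v) ->
  forall x, gen_ideal s H x <-> gen_ideal s K x.
Proof.
by move=> e x; split=> h I idI hI; apply: h => // v vv /e; exact: hI.
Qed.

Lemma perp_generated J : is_ideal J -> basic_ideal s J -> graded_ideal s ss J ->
  forall x, perp J x <-> gen_ideal s (fun v => vertex v /\ ~ Hbar s J v) x.
Proof.
move=> idJ bJ gJ x; apply: iff_trans (gen_ideal_ext (Hset_perp idJ bJ gJ) x).
apply: basic_graded_generated; first exact: perp_ideal.
  exact: perp_basic.
exact: perp_graded.
Qed.

(** H of the annihilator is the complement of [Hbar], so [w] avoids its [Hbar] exactly when no path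
    from [w] leaves [Hbar s J]. *)
Lemma notin_Hbar_perp J : is_ideal J -> basic_ideal s J -> graded_ideal s ss J ->
  forall w, vertex w /\ ~ Hbar s (perp J) w <->
    vertex w /\ forall v, Tset w v -> Hbar s J v.
Proof.
move=> idJ bJ gJ w; split=> -[vw h]; split=> //.
  move=> _ [l [rl <-]]; apply: contrapT => nl; apply: h; exists l; split=> //.
  by apply/(Hset_perp idJ bJ gJ); split=> //; exact: vertex_ks.
move=> [l [e /(Hset_perp idJ bJ gJ)[_ nl]]]; apply: nl; apply: h.
by exists l.
Qed.

End KumjianPask.

Theorem mainTheorem7 (k : nat) (L : kgraph k) (R : comNzRingType)
    (A : nualg R) (s ss : L -> A) (J : A -> Prop) :
  locally_convex L -> row_finite L ->
  is_KP_algebra s ss ->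
  is_ideal J -> basic_ideal s J -> graded_ideal s ss J ->
  [/\ (forall a, perp J a <->
         gen_ideal s (fun v : L => vertex v /\ ~ Hbar s J v) a),
      (forall a, perp (perp J) a <->
         gen_ideal s (fun w : L => vertex w /\ forall v, Tset w v -> Hbar s J v) a)
    & (regular J <->
         (forall w : L, Hset s J w <-> (vertex w /\ forall v, Tset w v -> Hbar s J v)))].
Proof.
move=> lc rf kpa idJ bJ gJ.
have idP := perp_ideal idJ.
have bP := perp_basic lc rf kpa idJ bJ gJ.
have gP := perp_graded lc rf kpa gJ.
have W w := notin_Hbar_perp lc rf kpa idJ bJ gJ w.
have PP a : perp (perp J) a <->
    gen_ideal s (fun w : L => vertex w /\ forall v, Tset w v -> Hbar s J v) a.
  (* Part (i) for the annihilator, with its generating vertices rewritten by [W]. *)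
  exact: iff_trans (perp_generated lc rf kpa idP bP gP a) (gen_ideal_ext _ W a).
split=> //; first exact: (perp_generated lc rf kpa idJ bJ gJ).
split=> [reg w|eqH a].
  (* The right-hand side is the vertex set of the double annihilator, which regularity identifies
     with that of [J]. *)
  rewrite -W -(Hset_perp lc rf kpa idP bP gP).
  by split=> -[vw Jw]; split=> //; apply/reg.
(* Both ideals are generated by vertex sets, which agree by [eqH]. *)
rewrite PP (basic_graded_generated rf kpa idJ bJ gJ).
by apply: gen_ideal_ext => w; rewrite eqH.
Qed.
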